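(* Let $G$ be a finite non-abelian group, let $p$ be the smallest prime dividing $|G|$, and let $H$ be a subgroup of $G$ with $H \neq Z(H,G)$ and $|[H,G]| = p$. Let $g \in K(H,G)$ and let $|E(\Gamma_{H,G}^g)|$ denote the number of edges of $\Gamma_{H,G}^g$. Then: (a) If $g = 1$, then $$2p|E(\Gamma_{H,G}^g)| = (p-1)\left[2|G|(|H| - |Z(H,G)|) - |H|(|H| - |Z(H)|)\right].$$ (b) If $g \neq 1$ and $g^2 = 1$, then $$2p|E(\Gamma_{H,G}^g)| = \begin{cases} 2|G|\left((p-1)|H| + |Z(H,G)|\right) - |H|\left((p-1)|H| + |Z(H)| + p\right), & \text{if } g \in H,\\ 2|G|\left((p-1)|H| + |Z(H,G)|\right) - p|H|(|H|+1), & \text{if } g \in G\setminus H.\end{cases}$$ (c) If $g \neq 1$ and $g^2 \neq 1$, then $$2p|E(\Gamma_{H,G}^g)| = \begin{cases} 2|G|\left((p-2)|H| + 2|Z(H,G)|\right) - |H|\left((p-2)|H| + 2|Z(H)| + p\right), & \text{if } g \in H,\\ 2|G|\left((p-2)|H| + 2|Z(H,G)|\right) - p|H|(|H|+1), & \text{if } g \in G\setminus H.\end{cases}$$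
   Context: For $x,y$ in a group, $[x,y] = x^{-1}y^{-1}xy$. For a subgroup $H$ of $G$: $Z(H,G) = \{x \in H : xy = yx \text{ for all } y \in G\}$, $Z(H)$ is the center of $H$, $K(H,G) = \{[x,y] : x \in H,\ y \in G\}$, and $[H,G] = \langle K(H,G)\rangle$. The relative $g$-noncommuting graph $\Gamma_{H,G}^g$ is the simple undirected graph with vertex set $G$ in which two distinct vertices $x,y$ are adjacent if and only if ($x \in H$ or $y \in H$) and $[x,y] \neq g$ and $[x,y] \neq g^{-1}$. *)

(* Defs.v *)
From HB Require Import structures.
From mathcomp Require Import all_boot all_order all_algebra all_fingroup all_solvable.

Set Implicit Arguments.
Unset Strict Implicit.
Unset Printing Implicit Defensive.

Import GroupScope.

(* The library's commutator is [~ x, y] = x^-1 * (y^-1 * (x * y)). *)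
Definition relgnc_adj (gT : finGroupType) (H G : {set gT}) (g : gT) : rel gT :=
  fun x y => [&& x \in G, y \in G, x != y, (x \in H) || (y \in H),
                 [~ x, y] != g & [~ x, y] != g^-1].

Lemma relgnc_adj_sym (gT : finGroupType) (H G : {set gT}) (g : gT) :
  symmetric (relgnc_adj H G g).
Proof.
move=> x y; rewrite /relgnc_adj -(invg_comm x y) (inv_eq invgK).
rewrite (inj_eq invg_inj) (eq_sym y) (orbC (y \in H)).
by do 2![case: (_ \in G) => //=]; case: (_ != _) => //=; case: (_ || _) => //=; rewrite andbC.
Qed.

Lemma relgnc_adj_irrefl (gT : finGroupType) (H G : {set gT}) (g : gT) :
  irreflexive (relgnc_adj H G g).
Proof. by move=> x; rewrite /relgnc_adj eqxx /= !andbF. Qed.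

(* Edges are unordered pairs, so each one is counted once. *)
Definition relgnc_edges (gT : finGroupType) (H G : {set gT}) (g : gT) :
    {set {set gT}} :=
  [set [set x; y] | x in G, y in G & relgnc_adj H G g x y].

(* Main.v *)
Require Import Defs.
From HB Require Import structures.
From mathcomp Require Import all_boot all_order all_algebra all_fingroup all_solvable.
From mathcomp Require Import zify.

Set Implicit Arguments.
Unset Strict Implicit.
Unset Printing Implicit Defensive.

Import GroupScope GRing.Theory.


(** Twice the number of edges is the number of ordered pairs of adjacent
vertices, so everything reduces to counting ordered pairs (x, y) of G x G with
x or y in H (the set [rel_pairs H G], the union of H x G and G x H) according
to the value of their commutator.

The counts rest on one fact. Let D be a subgroup containing all [x, y] with x
in H and y in A, of order at most every nontrivial divisor of #|A|. As x ^ y is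
x * [x, y], the class of x under A lies in the coset x D; its size divides #|A|,
so a class with more than one element fills the whole coset. Hence, for x not
centralising A, the map y |-> [x, y] takes each value of D equally often, namely
#|A| / #|D| times ([card_commg_row]), while for x centralising A it is constantly
1. Summing over x in H counts the pairs of H x A with a given commutator
([card_commg_setX]). With D = [H, G], whose order is the smallest prime divisor
of #|G|, this applies both to A = G and to A = H, and yields the contributions of
'C_H(G) and of 'Z(H) respectively; inclusion-exclusion on H x G and G x H
combines them ([card_commg_rel_pairs]).

A pair of [rel_pairs H G] fails to be adjacent when its commutator is g, or is
g^-1, or when it lies on the diagonal. These three cases overlap only as follows:
the first two coincide when g ^+ 2 = 1, and the diagonal lies in both when g = 1,
whence the three cases of the theorem ([card_relgnc_edges]). When g is outside H,
no commutator of elements of H equals g, which by the equal distribution above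
makes H abelian, so that #|'Z(H)| becomes #|H| ([center_of_commg_notin]). *)

(** * Edges as ordered pairs *)

(** The map sending an ordered pair to its unordered pair is two-to-one on the
related pairs, since irreflexivity keeps their components distinct. *)
Lemma card_sym_edges (T : finType) (e : rel T) :
  symmetric e -> irreflexive e ->
  #|[set u : T * T | e u.1 u.2]| =
    (2 * #|[set [set u.1; u.2] | u in [set u : T * T | e u.1 u.2]]|)%N.
Proof.
move=> e_sym e_irr; set A := [set u | _].
rewrite -sum1_card (partition_big_imset (fun u : T * T => [set u.1; u.2])) /=.
rewrite mulnC -sum_nat_const; apply: eq_bigr => _ /imsetP[[x y] Axy ->] /=.
have exy : e x y by rewrite inE in Axy.
have neq_xy : x != y by apply: contraTneq exy => ->; rewrite e_irr.
rewrite sum1dep_card (_ : [set _ | _] = [set (x, y); (y, x)]).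
  by rewrite cards2 xpair_eqE negb_and neq_xy.
apply/setP=> -[a b]; rewrite !inE /= !xpair_eqE.
apply/andP/orP=> [[eab /eqP/setP eq_ab_xy]|[] /andP[/eqP-> /eqP->]]; last first.
- by rewrite e_sym exy setUC eqxx.
- by rewrite exy eqxx.
have neq_ab : a != b by apply: contraTneq eab => ->; rewrite e_irr.
have := eq_ab_xy a; have := eq_ab_xy b; rewrite !inE !eqxx orbT /=.
move=> /esym b_xy /esym a_xy; case/orP: a_xy neq_ab => /eqP->.
  by case/orP: b_xy => /eqP->; rewrite ?eqxx //; left.
by case/orP: b_xy => /eqP->; rewrite ?eqxx //; right.
Qed.

(** * Commutators with a given value *)

Section CommutatorFibres.

Variable gT : finGroupType.
Implicit Types (x y c : gT) (H G A D : {group gT}).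

Definition commg_fibre c : {set gT * gT} := [set u | [~ u.1, u.2] == c].

(** The class of x under A is the full coset x D, so x * c = x ^ y0 for some y0
in A, and the y with [x, y] = c form the coset of 'C_A[x] through y0; the number
#|D| is then the index of 'C_A[x] in A. *)
Lemma card_commg_row D A x c :
    x \notin 'C(A) -> {in A, forall y, [~ x, y] \in D} ->
    (forall d, 1 < d -> d %| #|A| -> #|D| <= d)%N -> c \in D ->
  (#|D| * #|[set y in A | [~ x, y] == c]| = #|A|)%N.
Proof.
move=> ncAx sxAD leDA Dc.
have sxD : x ^: A \subset x *: D.
  apply/subsetP=> _ /imsetP[y Ay ->]; rewrite mem_lcoset -commgEl; exact: sxAD.
have x_class_gt1 : (1 < #|x ^: A|)%N.
  rewrite ltn_neqAle eq_sym -index_cent1 indexg_gt0 andbT indexg_eq1.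
  apply: contra ncAx; rewrite subsetI subxx /= => sAC.
  by rewrite -sub_cent1.
have leD : (#|x *: D| <= #|x ^: A|)%N.
  by rewrite card_lcoset leDA // -index_cent1 dvdn_indexg.
have /eqP def_xA : x ^: A == x *: D by rewrite eqEcard sxD.
have: x * c \in x ^: A by rewrite def_xA mem_lcoset mulKg.
case/imsetP=> y0 Ay0 def_xc.
rewrite (_ : [set y in A | _] = 'C_A[x] :* y0); last first.
  apply/setP=> y; rewrite mem_rcoset inE in_setI groupMr ?groupV //.
  case: (y \in A) => //=; rewrite commgEl -(inj_eq (mulgI x)) mulKVg def_xc.
  rewrite -(inj_eq (@conjg_inj _ y0^-1)) -!conjgM mulgV conjg1.
  apply/eqP/cent1P; first by move/conjg_fixP/commgP/commute_sym.
  by move/commute_sym/commgP/conjg_fixP.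
rewrite card_rcoset -(card_lcoset D x) -def_xA -index_cent1 mulnC.
by rewrite Lagrange ?subsetIl.
Qed.

(** Each x in H outside 'C(A) contributes #|A| / #|D| pairs, and each x in 'C_H(A)
contributes #|A| pairs if c = 1 and none otherwise. The terms are arranged so as
to avoid both division and truncated subtraction. *)
Lemma card_commg_setX H A D c :
    {in H & A, forall x y, [~ x, y] \in D} ->
    (forall d, 1 < d -> d %| #|A| -> #|D| <= d)%N -> c \in D ->
  (#|D| * #|setX H A :&: commg_fibre c| + #|'C_H(A)| * #|A| =
     #|H| * #|A| + (c == 1%g) * (#|D| * (#|'C_H(A)| * #|A|)))%N.
Proof.
move=> sHAD leDA Dc.
have cardC a : (#|'C_H(A)| * a = \sum_(x in H) (x \in 'C(A)) * a)%N.
  rewrite -sum_nat_const (eq_bigl (fun x => (x \in H) && (x \in 'C(A)))) /=.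
    by rewrite big_mkcondr; apply: eq_bigr => x _; case: ifP; rewrite ?mul1n.
  by move=> x; rewrite inE.
have -> : #|setX H A :&: commg_fibre c| =
    (\sum_(x in H) #|[set y in A | [~ x, y] == c]|)%N.
  rewrite -sum1_card (eq_bigr (fun x => \sum_(y in A | [~ x, y] == c) 1)%N).
    rewrite pair_big_dep; apply: eq_bigl => -[x y].
    by rewrite !inE /= andbA.
  by move=> x _; rewrite -sum1_card; apply: eq_bigl => y; rewrite inE.
rewrite !cardC -[(#|H| * _)%N]sum_nat_const !big_distrr /=.
rewrite -!big_split /=.
apply: eq_bigr => x Hx; case: (boolP (x \in 'C(A))) => [cAx | ncAx].
  rewrite !mul1n addnC; congr (_ + _)%N; case: eqP => [-> | neq_c1] /=.
    rewrite mul1n; congr (_ * #|pred_of_set _|)%N.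
    apply/setP=> y; rewrite inE andb_idr // => Ay.
    by apply/commgP/(centP cAx).
  suff -> : [set y in A | [~ x, y] == c] = set0 by rewrite cards0 muln0.
  apply/setP=> y; rewrite in_set0 inE; apply/andP=> -[Ay /eqP xy_c].
  by apply: neq_c1; rewrite -xy_c; apply/eqP/commgP/(centP cAx).
by rewrite !mul0n !muln0 !addn0 card_commg_row // => y Ay; exact: sHAD.
Qed.

Definition rel_pairs H G : {set gT * gT} := setX H G :|: setX G H.

Lemma setXI_sub H G : H \subset G -> setX H G :&: setX G H = setX H H.
Proof.
move=> sHG; apply/setP=> -[x y]; rewrite !inE /= andbACA.
congr (_ && _); first by rewrite andb_idr // => /(subsetP sHG).
by rewrite andb_idl // => /(subsetP sHG).
Qed.

Lemma card_rel_pairs H G : H \subset G ->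
  (#|rel_pairs H G| + #|H| * #|H| = 2 * (#|H| * #|G|))%N.
Proof.
move=> sHG; have := cardsUI (setX H G) (setX G H).
rewrite -/(rel_pairs H G) setXI_sub // !cardsX => ->.
by rewrite mul2n -addnn [(#|G| * _)%N]mulnC.
Qed.

(** Swapping the components of a pair inverts its commutator. *)
Lemma card_commg_setXC H G c :
  #|setX G H :&: commg_fibre c| = #|setX H G :&: commg_fibre c^-1|.
Proof.
pose swap (u : gT * gT) := (u.2, u.1).
have swapK : involutive swap by case.
rewrite -(card_imset (mem (_ :&: _)) (inv_inj swapK)); apply: eq_card => -[x y].
rewrite (can_imset_pre _ swapK) !inE /= -(invg_comm x y) (inv_eq invgK).
by rewrite [(y \in G) && _]andbC.
Qed.

(** Inclusion-exclusion: the fibre over c in H x G, plus that in G x H (as large as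
the fibre over c^-1 in H x G), minus that in H x H. The divisors of #|H| being
divisors of #|G|, the count of [card_commg_setX] is available for H x H too. *)
Lemma card_commg_rel_pairs H G D c :
    H \subset G -> {in H & G, forall x y, [~ x, y] \in D} ->
    (forall d, 1 < d -> d %| #|G| -> #|D| <= d)%N -> c \in D ->
  (#|D| * #|rel_pairs H G :&: commg_fibre c| + 2 * (#|'C_H(G)| * #|G|) +
     #|H| * #|H| + (c == 1%g) * (#|D| * (#|'Z(H)| * #|H|)) =
   2 * (#|H| * #|G|) + #|'Z(H)| * #|H| +
     (c == 1%g) * (2 * (#|D| * (#|'C_H(G)| * #|G|))))%N.
Proof.
move=> sHG sHGD leDG Dc.
have := cardsUI (setX H G :&: commg_fibre c) (setX G H :&: commg_fibre c).
rewrite -setIUl -setIIl setXI_sub // (card_commg_setXC H G).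
rewrite -/(rel_pairs H G) => eqUI.
have eqN := card_commg_setX sHGD leDG Dc.
have := card_commg_setX sHGD leDG (groupVr Dc); rewrite invg_eq1 => eqNV.
have eqM : (#|D| * #|setX H H :&: commg_fibre c| + #|'Z(H)| * #|H| =
  #|H| * #|H| + (c == 1%g) * (#|D| * (#|'Z(H)| * #|H|)))%N.
  apply: card_commg_setX => // [x y Hx Hy | d d_gt1 dv_d].
    by rewrite sHGD // (subsetP sHG).
  by rewrite leDG // (dvdn_trans dv_d) ?cardSg.
have arith (d hg hh zg zh q m n n' b : nat) : (q + m = n + n')%N ->
    (d * n + zg = hg + b * (d * zg))%N -> (d * n' + zg = hg + b * (d * zg))%N ->
    (d * m + zh = hh + b * (d * zh))%N ->
  (d * q + 2 * zg + hh + b * (d * zh) = 2 * hg + zh + b * (2 * (d * zg)))%N.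
  by move=> /(congr1 (muln d)); rewrite !mulnDr; lia.
exact: arith eqUI eqN eqNV eqM.
Qed.

End CommutatorFibres.

(** * The edges of the graph *)

(** A pair is adjacent, or has commutator g, or has commutator g^-1, or is
diagonal; the Boolean factors suppress the terms that would be counted twice,
since the diagonal lies in the fibre over 1. *)
Lemma card_rel_pairs_split (gT : finGroupType) (G H : {group gT}) (g : gT) :
    H \subset G ->
  (2 * #|relgnc_edges H G g| + #|rel_pairs H G :&: commg_fibre g| +
     (g != g^-1) * #|rel_pairs H G :&: commg_fibre g^-1| + (g != 1%g) * #|H| =
   #|rel_pairs H G|)%N.
Proof.
move=> sHG.
have -> : relgnc_edges H G g =
    [set [set u.1; u.2] | u in [set u | relgnc_adj H G g u.1 u.2]].
  apply/setP=> A; apply/imset2P/imsetP=> [[x y Gx] | [[x y]]].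
    by rewrite inE => /andP[_ adj_xy] ->; exists (x, y); rewrite ?inE.
  rewrite inE /= => adj_xy ->; have /and3P[Gx Gy _] := adj_xy.
  by exists x y; rewrite ?inE ?Gy.
rewrite -card_sym_edges; [|exact: relgnc_adj_sym|exact: relgnc_adj_irrefl].
have cardT (A : {set gT * gT}) :
    #|rel_pairs H G :&: A| = (\sum_(u in rel_pairs H G) (u \in A))%N.
  rewrite -sum1_card (eq_bigl _ _ (fun u => in_setI u _ _)) big_mkcondr /=.
  by apply: eq_bigr => u _; case: (u \in A).
have -> : [set u | relgnc_adj H G g u.1 u.2] =
    rel_pairs H G :&: [set u | relgnc_adj H G g u.1 u.2].
  apply/esym/setIidPr/subsetP=> -[x y]; rewrite !inE /=.
  by case/and5P=> -> -> _ /orP[]->; rewrite ?orbT.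
have -> : #|H| = #|rel_pairs H G :&: [set u | u.1 == u.2]|.
  have diag_inj : injective (fun x : gT => (x, x)) by move=> ? ? [].
  rewrite -(card_imset (mem H) diag_inj).
  apply: eq_card => -[x y]; rewrite !inE /= andbC.
  apply/imsetP/andP=> [[z Hz [-> ->]] | [/eqP <- Hxy]].
    by rewrite eqxx Hz (subsetP sHG).
  by exists x => //; case/orP: Hxy => /andP[].
(* All counts being sums of indicators over the same set, the identity is checked
   pair by pair. *)
rewrite !cardT 2!big_distrr -3!big_split -sum1_card /=.
apply: eq_bigr => -[x y]; rewrite !inE /relgnc_adj /= => Txy.
have [-> ->] : (x \in G) /\ (y \in G).
  by case/orP: Txy => /andP[? ?]; split=> //; apply: (subsetP sHG).
have -> /= : (x \in H) || (y \in H).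
  by case/orP: Txy => /andP[Hx Hy]; rewrite ?Hx ?Hy ?orbT.
case: (x =P y) => [<- | _] /=.
  rewrite commgg ![1%g == _]eq_sym invg_eq1.
  by case: (g =P 1%g) => [-> | _]; rewrite ?invg1 ?eqxx ?muln0.
rewrite muln0 addn0; case: ([~ x, y] =P g) => [-> | /eqP] /=.
  by case: (g == g^-1).
rewrite addn0; case: ([~ x, y] =P g^-1) => [-> | _ _] /=; last by rewrite muln0.
by rewrite eq_sym => ->.
Qed.

(** The factor 1 + (g ^+ 2 != 1) is the number of distinct values among g and g^-1,
whose fibres have the same size; all terms are kept positive, so that the
subtractions of the final formulas can be carried out in the integers. *)
Lemma card_relgnc_edges (gT : finGroupType) (G H D : {group gT}) (g : gT) :
    H \subset G -> {in H & G, forall x y, [~ x, y] \in D} ->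
    (forall d, 1 < d -> d %| #|G| -> #|D| <= d)%N -> g \in D ->
  (#|D| * (2 * #|relgnc_edges H G g| + (g != 1%g) * #|H| + #|H| * #|H|) +
     (1 + (g ^+ 2 != 1%g)) * (2 * (#|H| * #|G|) + #|'Z(H)| * #|H| +
        (g == 1%g) * (2 * (#|D| * (#|'C_H(G)| * #|G|)))) =
   #|D| * (2 * (#|H| * #|G|)) +
     (1 + (g ^+ 2 != 1%g)) * (2 * (#|'C_H(G)| * #|G|) + #|H| * #|H| +
        (g == 1%g) * (#|D| * (#|'Z(H)| * #|H|))))%N.
Proof.
move=> sHG sHGD leDG Dg; have eqT := card_rel_pairs sHG.
have eqQ := card_commg_rel_pairs sHG sHGD leDG Dg.
have := card_commg_rel_pairs sHG sHGD leDG (groupVr Dg).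
have := card_rel_pairs_split g sHG.
rewrite invg_eq1 [g == g^-1]eq_mulgV1 invgK => eqE eqQV.
have arith (d e q q' t hg hh h zg zh b b1 b2 : nat) :
    (t + hh = 2 * hg)%N -> (2 * e + q + b2 * q' + b1 * h = t)%N ->
    (d * q + 2 * zg + hh + b * (d * zh) =
       2 * hg + zh + b * (2 * (d * zg)))%N ->
    (d * q' + 2 * zg + hh + b * (d * zh) =
       2 * hg + zh + b * (2 * (d * zg)))%N ->
  (d * (2 * e + b1 * h + hh) +
     (1 + b2) * (2 * hg + zh + b * (2 * (d * zg))) =
   d * (2 * hg) + (1 + b2) * (2 * zg + hh + b * (d * zh)))%N.
  move=> /(congr1 (muln d)) ? /(congr1 (muln d)) ? ? /(congr1 (muln b2)) ?; lia.
exact: arith eqT eqE eqQ eqQV.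
Qed.

(** If some x of H failed to centralise H, the commutators [x, y] with y in H would
take every value in D, among them g, which would then be in H. *)
Lemma center_of_commg_notin (gT : finGroupType) (H D : {group gT}) (g : gT) :
    {in H &, forall x y, [~ x, y] \in D} ->
    (forall d, 1 < d -> d %| #|H| -> #|D| <= d)%N -> g \in D ->
  g \notin H -> 'Z(H) = H.
Proof.
move=> sHD leDH Dg notHg; apply/center_idP/subsetP=> x Hx.
apply: contraR notHg => ncHx.
have := card_commg_row ncHx (fun y => sHD x y Hx) leDH Dg.
have [-> | [y]] := set_0Vmem [set y in H | [~ x, y] == g].
  by rewrite cards0 muln0 => H0; have := cardG_gt0 H; rewrite -H0.
by rewrite inE => /andP[Hy /eqP <-] _; rewrite groupR.
Qed.

Theorem proposition3p3 (gT : finGroupType) (G H : {group gT}) (p : nat) (g : gT)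
    (nabG : ~~ abelian G) (def_p : p = pdiv #|G|) (sHG : H \subset G)
    (neHZ : H :!=: 'C_H(G)) (oHG : #|[~: H, G]| = p)
    (Kg : g \in commg_set H G) :
  let P := Posz p in
  let E := Posz #|relgnc_edges H G g| in
  let oG := Posz #|G| in
  let oH := Posz #|H| in
  let oZHG := Posz #|'C_H(G)| in
  let oZH := Posz #|'Z(H)| in
  [/\ g = 1 ->
        (2 * P * E = (P - 1) * (2 * oG * (oH - oZHG) - oH * (oH - oZH)))%R,
      g != 1 -> g ^+ 2 = 1 ->
        (g \in H ->
           (2 * P * E = 2 * oG * ((P - 1) * oH + oZHG)
                        - oH * ((P - 1) * oH + oZH + P))%R) /\
        (g \in G :\: H ->
           (2 * P * E = 2 * oG * ((P - 1) * oH + oZHG)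
                        - P * oH * (oH + 1))%R)
    & g != 1 -> g ^+ 2 != 1 ->
        (g \in H ->
           (2 * P * E = 2 * oG * ((P - 2) * oH + 2 * oZHG)
                        - oH * ((P - 2) * oH + 2 * oZH + P))%R) /\
        (g \in G :\: H ->
           (2 * P * E = 2 * oG * ((P - 2) * oH + 2 * oZHG)
                        - P * oH * (oH + 1))%R)].
Proof.
have G_gt1 : (1 < #|G|)%N.
  by rewrite ltnNge -trivg_card_le1; apply: contra nabG => /eqP->; rewrite abelian1.
have sHGD : {in H & G, forall x y, [~ x, y] \in [~: H, G]%G}.
  by move=> x y; apply: mem_commg.
have leDG d : (1 < d -> d %| #|G| -> #|[~: H, G]%G| <= d)%N.
  by move=> d_gt1 dv_d; rewrite oHG def_p pdiv_min_dvd.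
have Dg : g \in [~: H, G]%G by rewrite mem_gen.
have ZH : g \notin H -> #|'Z(H)| = #|H|.
  move=> notHg.
  rewrite (center_of_commg_notin _ _ Dg notHg) // => [x y Hx Hy | d d_gt1 dv_d].
    by rewrite sHGD // (subsetP sHG).
  by rewrite leDG // (dvdn_trans dv_d) ?cardSg.
have := card_relgnc_edges sHG sHGD leDG Dg.
rewrite oHG => main P E oG oH oZHG oZH.
split=> [g1 | /negPf g1 g2 | /negPf g1 /negPf g2].
- have g2 : g ^+ 2 = 1 by rewrite g1 expg1n.
  by move/eqP: g1 => g1; rewrite g1 g2 eqxx in main; lia.
- rewrite g1 g2 eqxx in main; split=> [_ | /setDP[_ /ZH defZ]]; first lia.
  by rewrite defZ in main; lia.
rewrite g1 g2 in main; split=> [_ | /setDP[_ /ZH defZ]]; first lia.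
by rewrite defZ in main; lia.
Qed.
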